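(* Let $A\in\mathbb{R}^{n\times n}$ be symmetric with graph $\mathcal{G}(A)$, let $f$ be a real function defined on the spectrum of $A$, let $d\ge1$ be an integer, and assume that $f(A)$ has the exponential decay property $|[f(A)]_{ij}|\le c\,q^{\mathrm{d}(i,j)}$ for all $i,j$, with constants $c>0$ and $0<q<1$ independent of $i,j$. (i) If $A$ is $\beta$-banded (i.e. $[A]_{ij}=0$ for $|i-j|>\beta$, $\beta\geq 1$ an integer) and $C_1,\dots,C_m$, $m=d\beta+1$, is the distance-$d$ coloring given by $\operatorname{col}(i)=(i-1)\bmod(d\beta+1)+1$, $i=1,\dots,n$, then for every $\ell$ $$V_\ell\le n_\ell\cdot 4c^2\,\frac{q^{2d}}{1-q^{2d}}.$$ (ii) If $\mathcal{G}(A)$ is a regular $D$-dimensional lattice and $C_1,\dots,C_m$, $m=(d+1)^D$, is the distance-$d$ coloring given by $$\operatorname{col}(v)=\Big(\sum_{k=1}^{D}\big([v]_k\bmod(d+1)\big)(d+1)^{k-1}\Big)+1,$$ then for every $\ell$ $$V_\ell\le n_\ell\cdot4c^2D\,\mathrm{Li}_{1-D}(q^{2d}).$$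
   Context: For symmetric $A$, $f(A)$ is the matrix function defined through the spectral decomposition. $[M]_{ij}$ is the $(i,j)$ entry of $M$. $\mathcal{G}(A)=(V,E)$ is the undirected graph with $V=\{1,\dots,n\}$ and $E=\{(i,j): i\ne j,\ [A]_{ij}\ne 0\}$; $\mathrm{d}(i,j)$ is the geodesic (shortest path) distance in $\mathcal{G}(A)$, with $\mathrm{d}(i,i)=0$, and $\mathrm{d}(i,j)=\infty$, $q^{\infty}=0$ if there is no path. A coloring $\operatorname{col}:V\to\{1,\dots,m\}$ gives the color classes $C_\ell=\{i\in V:\operatorname{col}(i)=\ell\}$, and $n_\ell=|C_\ell|$. A regular $D$-dimensional lattice of size $L_1\times\dots\times L_D$ ($D\ge1$, $n=L_1\cdots L_D$) is the graph with nodes labeled by $\{v\in\mathbb{Z}^D:0\le[v]_k\le L_k-1,\ k=1,\dots,D\}$, where two nodes are adjacent exactly when they differ by $1$ in one coordinate and agree in all the others. $V_\ell$ is the variance of $\boldsymbol{w}_\ell^Tf(A)\boldsymbol{w}_\ell$, where $\boldsymbol{w}_\ell=\sum_{i\in C_\ell}X_i\boldsymbol{e}_i$ with $X_i$ i.i.d. taking the values $\pm1$ with probability $\tfrac12$ each ($\boldsymbol{e}_i$ the canonical basis vectors); explicitly $V_\ell=2\sum_{i,j\in C_\ell,\,i\ne j}|[f(A)]_{ij}|^2$. The polylogarithm is $\mathrm{Li}_s(z)=\sum_{k=1}^\infty z^k/k^s$, so $\mathrm{Li}_{1-D}(z)=\sum_{k\ge1}k^{D-1}z^k$ for $|z|<1$.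 *)

(* Defs.v *)
From HB Require Import structures.
From mathcomp Require Import all_boot all_order all_algebra.
From mathcomp Require Import all_classical all_reals all_analysis.
From mathcomp Require Import lra.
From mathcomp.real_closed Require Import complex.

Set Implicit Arguments.
Unset Strict Implicit.
Unset Printing Implicit Defensive.

Import Order.TTheory GRing.Theory Num.Theory.
Import numFieldNormedType.Exports.

Local Open Scope ring_scope.

Definition spectral_decomposition (R : realType) (n : nat) (A Q : 'M[R]_n)
    (lam : 'rV[R]_n) : Prop :=
  Q *m Q^T = 1%:M /\ A = Q *m diag_mx lam *m Q^T.

(* [f(A) = Q f(Lambda) Q^T] for a chosen decomposition [A = Q Lambda Q^T]; the
   choice is irrelevant and, for symmetric [A], always possible: see [matfunE]
   and [spectral_decomposition_exists]. *)
Definition matfun (R : realType) (n : nat) (f : R -> R) (A : 'M[R]_n) :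
    'M[R]_n :=
  let Ql := xget (0, 0)
    [set Ql : 'M[R]_n * 'rV[R]_n | spectral_decomposition A Ql.1 Ql.2]%classic
  in Ql.1 *m diag_mx (map_mx f Ql.2) *m Ql.1^T.

Lemma matfunE (R : realType) (n : nat) (f : R -> R) (A Q : 'M[R]_n)
    (lam : 'rV[R]_n) : spectral_decomposition A Q lam ->
  matfun f A = Q *m diag_mx (map_mx f lam) *m Q^T.
Proof.
move=> AQ; rewrite /matfun; case: xgetP => [[Q' lam'] _ /= AQ'|/(_ (Q, lam))//].
have {AQ AQ'} [[QQ AE] [QQ' AE']] := (AQ, AQ').
have QtQ := mulmx1C QQ; have QtQ' := mulmx1C QQ'.
pose W := Q'^T *m Q.
have WE : W *m diag_mx lam = diag_mx lam' *m W.
  transitivity (Q'^T *m A *m Q).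
    by rewrite AE -!mulmxA QtQ mulmx1 !mulmxA.
  by rewrite AE' !mulmxA QtQ' mul1mx.
have fWE : W *m diag_mx (map_mx f lam) = diag_mx (map_mx f lam') *m W.
  apply/matrixP => i j; move/matrixP/(_ i j): WE.
  rewrite !mul_mx_diag !mul_diag_mx !mxE.
  move: (\sum_k _) => w; have [->|w0] := eqVneq w 0.
    by rewrite !mulr0 !mul0r.
  by rewrite [LHS]mulrC => /(mulIf w0) ->; rewrite mulrC.
have QE : Q = Q' *m W by rewrite mulmxA QQ' mul1mx.
have -> : Q *m diag_mx (map_mx f lam) *m Q^T =
    Q' *m (W *m diag_mx (map_mx f lam)) *m Q^T by rewrite {1}QE !mulmxA.
rewrite fWE -!mulmxA; congr (_ *m (_ *m _)).
by rewrite QQ mulmx1.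
Qed.

Lemma sym_eigenvector (R : realType) (n : nat) (A : 'M[R]_n.+1) : A^T = A ->
  exists (a : R) (u : 'rV[R]_n.+1), u *m u^T = 1%:M /\ u *m A = a *: u.
Proof.
move=> As.
suff [a [u u0 uA]] : exists a : R,
    exists2 u : 'rV[R]_n.+1, u != 0 & u *m A = a *: u.
  have uu : u *m u^T = (\sum_k u 0 k ^+ 2)%:M.
    by rewrite [LHS]mx11_scalar mxE; congr _%:M; apply: eq_bigr => k _; rewrite !mxE expr2.
  have s_gt0 : 0 < \sum_k u 0 k ^+ 2.
    rewrite lt_def sumr_ge0 ?andbT; last by move=> k _; rewrite sqr_ge0.
    apply: contra_neq u0 => /psumr_eq0P s0; apply/rowP => k; rewrite mxE.
    by apply/eqP; rewrite -sqrf_eq0; apply/eqP/s0 => // i _; rewrite sqr_ge0.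
  set s := \sum_k _ in uu s_gt0; exists a, ((Num.sqrt s)^-1 *: u); split; last first.
    by rewrite -scalemxAl uA !scalerA mulrC.
  rewrite linearZ /= -scalemxAl -scalemxAr uu scalerA -expr2 exprVn sqr_sqrtr ?ltW//.
  by rewrite scale_scalar_mx mulVf// gt_eqF.
pose toC := complex.real_complex_def (Phant R).
have [a /eigenvalueP [v vA v0]] := @eigenvalue_closed (complex.complex R) _ (map_mx toC A) isT.
pose x := map_mx (@complex.Re R) v; pose y := map_mx (@complex.Im R) v.
pose p := complex.Re a; pose q := complex.Im a.
have ReM (z w : complex.complex R) : complex.Re (z * w) =
  complex.Re z * complex.Re w - complex.Im z * complex.Im w by case: z w => ? ? [].
have ImM (z w : complex.complex R) : complex.Im (z * w) =
  complex.Re z * complex.Im w + complex.Im z * complex.Re w by case: z w => ? ? [].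
have ReS (F : 'I_n.+1 -> complex.complex R) :
    complex.Re (\sum_i F i) = \sum_i complex.Re (F i).
  by apply: (big_morph (@complex.Re R)) => // -[? ?] [].
have ImS (F : 'I_n.+1 -> complex.complex R) :
    complex.Im (\sum_i F i) = \sum_i complex.Im (F i).
  by apply: (big_morph (@complex.Im R)) => // -[? ?] [].
have xA : x *m A = p *: x - q *: y.
  apply/rowP => j; move/rowP/(_ j)/(congr1 (@complex.Re R)): vA.
  rewrite !mxE ReS ReM => <-; apply: eq_bigr => k _.
  by rewrite !mxE ReM /= mulr0 subr0.
have yA : y *m A = p *: y + q *: x.
  apply/rowP => j; move/rowP/(_ j)/(congr1 (@complex.Im R)): vA.
  rewrite !mxE ImS ImM => <-; apply: eq_bigr => k _.
  by rewrite !mxE ImM /= mulr0 add0r.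
have q0 : q = 0.
  have : (x *m A *m y^T)^T = y *m A *m x^T.
    by rewrite !trmx_mul trmxK As mulmxA.
  rewrite xA yA mulmxBl mulmxDl -!scalemxAl linearB /= !linearZ /= !trmx_mul !trmxK.
  move=> /addrI /eqP; rewrite eq_sym -subr_eq0 -scalerBr opprK scaler_eq0.
  case/orP=> [/eqP//|/eqP/matrixP/(_ 0 0)]; rewrite !mxE -big_split /=.
  have ge0 k : 0 <= x 0 k * x^T k 0 + y 0 k * y^T k 0.
    by rewrite [x^T _ _]mxE [y^T _ _]mxE addr_ge0 // -expr2 sqr_ge0.
  move/psumr_eq0P => s0; case/eqP: v0; apply/rowP => k.
  have /eqP := s0 (fun k _ => ge0 k) k isT.
  rewrite [x^T _ _]mxE [y^T _ _]mxE -!expr2 paddr_eq0 ?sqr_ge0// !sqrf_eq0 !mxE.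
  by case: (v 0 k) => /= ? ? /andP[/eqP-> /eqP->].
rewrite q0 !scale0r subr0 addr0 in xA yA.
exists p; have [x0|x0] := eqVneq x 0; last by exists x.
exists y => //; apply: contra_neq v0 => y0; apply/rowP => k.
move/rowP/(_ k): x0; move/rowP/(_ k): y0; rewrite !mxE.
by case: (v 0 k) => /= ? ? -> ->.
Qed.

Lemma spectral_decomposition_exists (R : realType) (n : nat) (A : 'M[R]_n) :
  A^T = A -> exists Q lam, spectral_decomposition A Q lam.
Proof.
elim: n A => [|n IH] A As.
  by exists 1%:M, 0; split; [rewrite trmx1 mulmx1 | apply/matrixP => -[]].
have [a [u [uu uA]]] := sym_eigenvector As.
have [H [Hs HH eH]] : exists H : 'M[R]_n.+1,
    [/\ H^T = H, H *m H = 1%:M & (delta_mx 0 0 : 'rV_n.+1) *m H = u].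
  set e : 'rV[R]_n.+1 := delta_mx 0 0; have [w wE] : exists w, w = u - e by exists (u - e).
  have ee : e *m e^T = 1%:M.
    by rewrite trmx_delta mul_delta_mx; apply/matrixP => i j; rewrite !mxE !ord1.
  pose t := (u *m e^T) 0 0; have ue : u *m e^T = t%:M by exact: mx11_scalar.
  have eu : e *m u^T = t%:M by rewrite -[RHS]tr_scalar_mx -ue trmx_mul trmxK.
  have ww : w *m w^T = (2 * (1 - t))%:M.
    rewrite wE linearB /= mulmxBl !mulmxBr uu ee ue eu.
    by apply/matrixP => i j; rewrite !mxE !ord1 /=; lra.
  have ew : e *m w^T = (t - 1)%:M.
    rewrite wE linearB /= mulmxBr ee eu.
    by apply/matrixP => i j; rewrite !mxE !ord1.
  have [t1|t1] := eqVneq (1 - t) 0.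
    exists 1%:M; rewrite trmx1 !mulmx1; split=> //.
    rewrite t1 mulr0 in ww; apply/esym/eqP; rewrite -subr_eq0 -wE; apply/eqP/rowP => k.
    move/matrixP/(_ 0 0): ww; rewrite !mxE /= mul0rn => /psumr_eq0P.
    have h i : true -> 0 <= w 0 i * w^T i 0 by rewrite mxE -expr2 sqr_ge0.
    move=> /(_ h k isT)/eqP; rewrite [w^T _ _]mxE -expr2 sqrf_eq0 => /eqP.
    by [].
  pose H := 1%:M - (1 - t)^-1 *: (w^T *m w).
  exists H; split.
  - by rewrite /H linearB /= trmx1 linearZ /= trmx_mul trmxK.
  - have PP : w^T *m w *m (w^T *m w) = (2 * (1 - t)) *: (w^T *m w).
      by rewrite -mulmxA (mulmxA w) ww mul_scalar_mx -scalemxAr.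
    rewrite /H mulmxBl mul1mx mulmxBr mulmx1 -scalemxAl -scalemxAr PP !scalerA.
    have -> : (1 - t)^-1 * (1 - t)^-1 * (2 * (1 - t)) = 2 * (1 - t)^-1.
      by rewrite -mulrA [_^-1 * (2 * _)]mulrCA mulVf // mulr1 mulrC.
    by rewrite mulr_natl mulr2n scalerDl; apply/matrixP => i j; rewrite !mxE; lra.
  - rewrite /H mulmxBr mulmx1 -scalemxAr mulmxA ew mul_scalar_mx scalerA.
    rewrite -(opprB 1 t) mulrN mulVf // scaleN1r opprK wE addrC subrK //.
have [B BdE] : exists B : 'M[R]_(1 + n), B = H *m A *m H by exists (H *m A *m H).
have Bs : B^T = B by rewrite BdE !trmx_mul Hs As mulmxA.
have uH : u *m H = delta_mx 0 0 by rewrite -eH -mulmxA HH mulmx1.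
have eB : (delta_mx 0 0 : 'rV_(1 + n)) *m B = a *: delta_mx 0 0.
  by rewrite BdE !mulmxA eH uA -scalemxAl uH.
have B0 j : B 0 j = a * (j == 0)%:R.
  by move/rowP/(_ j): eB; rewrite -rowE !mxE eqxx.
have BE : B = block_mx a%:M 0 0 (drsubmx B).
  rewrite -[LHS]submxK; congr block_mx.
  - apply/matrixP => i j; rewrite !mxE !ord1 /=.
    have -> : lshift n (0 : 'I_1) = 0 by apply/val_inj.
    by rewrite B0 eqxx mulr1.
  - apply/matrixP => i j; rewrite !mxE !ord1 /=.
    have -> : lshift n (0 : 'I_1) = 0 by apply/val_inj.
    by rewrite B0 mulr0.
  - apply/matrixP => i j; rewrite !mxE !ord1 /= -Bs mxE.
    have -> : lshift n (0 : 'I_1) = 0 by apply/val_inj.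
    by rewrite B0 mulr0.
have [Q [lam [QQ QE]]] : exists Q lam, spectral_decomposition (drsubmx B) Q lam.
  by apply: IH; rewrite -[in RHS]Bs trmx_drsub.
have [S SE] : exists S : 'M[R]_(1 + n), S = block_mx 1%:M 0 0 Q.
  by exists (block_mx 1%:M 0 0 Q).
have StE : S^T = block_mx 1%:M 0 0 Q^T by rewrite SE tr_block_mx !trmx0 trmx1.
have SS : S *m S^T = 1%:M.
  rewrite StE SE mulmx_block !mulmx0 !mul0mx !mulmx1 !addr0 !add0r QQ.
  by rewrite -scalar_mx_block.
have SB : S *m diag_mx (row_mx a%:M lam) *m S^T = B.
  have -> : diag_mx (row_mx (a%:M : 'M[R]_1) lam) = block_mx a%:M 0 0 (diag_mx lam).
    by rewrite diag_mx_row; congr block_mx; apply/matrixP => i j; rewrite !mxE !ord1.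
  rewrite StE SE BE !mulmx_block !mulmx0 !mul0mx !mul1mx !mulmx1 !addr0 !add0r.
  by rewrite !mul0mx QE.
exists (H *m S), (row_mx a%:M lam); split.
  by rewrite trmx_mul Hs -mulmxA (mulmxA S) SS mul1mx.
rewrite trmx_mul Hs.
transitivity (H *m B *m H).
  by rewrite BdE !mulmxA HH mul1mx -mulmxA HH mulmx1.
by rewrite -SB !mulmxA.
Qed.

Definition mxgraph (R : realType) (n : nat) (A : 'M[R]_n) : rel 'I_n :=
  fun i j => (i != j) && (A i j != 0).

Definition has_walk (T : finType) (e : rel T) (i j : T) (k : nat) : bool :=
  [exists p : k.-tuple T, path e i p && (last i p == j)].

(* [None] stands for an infinite distance. *)
Definition geodist (T : finType) (e : rel T) (i j : T) : option nat :=
  match pselect (exists k, has_walk e i j k) with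
  | left ex => Some (ex_minn ex)
  | right _ => None
  end.

Definition qpow (R : realType) (q : R) (k : option nat) : R :=
  if k is Some m then q ^+ m else 0.

Definition banded (R : realType) (n : nat) (b : nat) (A : 'M[R]_n) : Prop :=
  forall i j : 'I_n, (b < `|i - j|)%N -> A i j = 0.

(* The nodes [1, ..., n] are represented by [0, ..., n - 1], whence [i] where
   the usual formula has [i - 1]. Colors are numbered from 1. *)
Definition band_col (n d b : nat) (i : 'I_n) : nat := (i %% (d * b + 1) + 1)%N.

Definition lattice (D : nat) (L : 'I_D -> nat) : finType :=
  {dffun forall k : 'I_D, 'I_(L k)}.

Definition lattice_adj (D : nat) (L : 'I_D -> nat) : rel (lattice L) :=
  fun u v => [exists k : 'I_D, (`|u k - v k|%N == 1%N) &&
    [forall (j : 'I_D | j != k), u j == v j]].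

Definition lattice_labeling (n : nat) (e : rel 'I_n) (D : nat) (L : 'I_D -> nat)
    (v : 'I_n -> lattice L) : Prop :=
  bijective v /\ forall i j, e i j = lattice_adj (v i) (v j).

Definition lattice_col (d D : nat) (L : 'I_D -> nat) (v : lattice L) : nat :=
  (\sum_(k < D) (v k %% (d + 1)) * (d + 1) ^ k + 1)%N.

Definition color_class (n : nat) (col : 'I_n -> nat) (l : nat) : {set 'I_n} :=
  [set i | col i == l]%SET.

Section Random.
Context {R : realType} {disp : measure_display} {T : measurableType disp}.
Variables (P : probability T R) (n : nat).

Definition independent_on (C : {set 'I_n}) (X : 'I_n -> {RV P >-> R}) : Prop :=
  forall (J : {set 'I_n}) (B : 'I_n -> set R), J \subset C ->
    (forall i, i \in J -> measurable (B i)) ->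
    P [set t | forall i, i \in J -> B i (X i t)]%classic
    = (\prod_(i in J) P (X i @^-1` B i)%classic)%E.

Definition rademacher (X : {RV P >-> R}) : Prop :=
  P [set t | X t = 1]%classic = (2^-1)%:E /\
  P [set t | X t = -1]%classic = (2^-1)%:E.

Definition iid_rademacher (C : {set 'I_n}) (X : 'I_n -> {RV P >-> R}) : Prop :=
  independent_on C X /\ forall i, i \in C -> rademacher (X i).

Definition probing_vector (C : {set 'I_n}) (X : 'I_n -> {RV P >-> R}) (t : T) :
    'cV[R]_n :=
  \sum_(i in C) X i t *: delta_mx i 0.

Definition probing_form (B : 'M[R]_n) (C : {set 'I_n})
    (X : 'I_n -> {RV P >-> R}) (t : T) : R :=
  ((probing_vector C X t)^T *m B *m probing_vector C X t) 0 0.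

Definition probing_variance (B : 'M[R]_n) (C : {set 'I_n})
    (X : 'I_n -> {RV P >-> R}) : \bar R :=
  'V_P[probing_form B C X]%E.

End Random.

Definition polylog (R : realType) (s : int) (z : R) : R :=
  limn (fun N : nat => \sum_(1 <= k < N) z ^+ k / (k%:R ^ s)).

(* Main.v *)
(* For symmetric B the variance of w^T B w, with w a vector of random signs on C,
   is 2 * sum_(i != j in C) B_ij^2, so it suffices to bound, for i in C, the sum of
   q^(2 d(i,j)) over j in C different from i.  With x = q^(2d) and indices of one
   color agreeing modulo d*b+1 (resp. coordinatewise modulo d+1), d(i,j) >= d * s where s is
   the number of periods separating i and j, so the sum is at most 2x/(1-x) in the
   banded case, and ((1+x)/(1-x))^D - 1 in the lattice case.  The latter is at most
   2 D Li_(1-D)(x) by induction on D: multiplying by 1-x and comparing coefficients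
   leaves m (k^(m-1) + (k-1)^(m-1)) <= (m+1) (k^m - (k-1)^m) for k >= 2. *)
Require Import Defs.
From HB Require Import structures.
From mathcomp Require Import all_boot all_order all_algebra.
From mathcomp Require Import all_classical all_reals all_analysis.
From mathcomp Require Import measurable_realfun.
From mathcomp Require Import ring lra zify.

Import Order.TTheory GRing.Theory Num.Theory.
Import numFieldNormedType.Exports.

Local Open Scope ring_scope.

(** * Geometric sums over distinct exponents *)

Lemma sum_geometric_le (R : realFieldType) (x : R) (N : nat) : 0 <= x < 1 ->
  \sum_(1 <= k < N) x ^+ k <= x / (1 - x).
Proof.
move=> /andP[x0 x1]; have x1' : 0 < 1 - x by rewrite subr_gt0.
case: N => [|N]; first by rewrite big_geq// divr_ge0 // ltW.
suff -> : \sum_(1 <= k < N.+1) x ^+ k = (x - x ^+ N.+1) / (1 - x).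
  by rewrite ler_pM2r ?invr_gt0// gerBl exprn_ge0.
elim: N => [|N IH]; first by rewrite big_geq// expr1 subrr mul0r.
rewrite big_nat_recr//= IH [x ^+ N.+2]exprS; field; exact: lt0r_neq0.
Qed.

(** Distinct positive exponents make this a subsum, with nonnegative terms left out, of the
    geometric series that starts at exponent 1. *)
Lemma sum_distinct_exp_le (R : realFieldType) (I : finType) (C : pred I)
    (kappa : I -> nat) (x : R) : 0 <= x < 1 ->
  {in C &, injective kappa} -> (forall i, i \in C -> (0 < kappa i)%N) ->
  \sum_(i in C) x ^+ kappa i <= x / (1 - x).
Proof.
move=> x01 kinj kpos; pose N := (\max_(i in C) kappa i).+1.
apply: le_trans (sum_geometric_le _ _ N x01).
have -> : \sum_(i in C) x ^+ kappa i =
    \sum_(k <- index_iota 1 N | k \in map kappa (enum C)) x ^+ k.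
  rewrite -big_enum -(big_map kappa predT (fun k => x ^+ k)) -[RHS]big_filter.
  apply: perm_big; apply: uniq_perm.
  - by rewrite map_inj_in_uniq ?enum_uniq// => i j; rewrite !mem_enum; apply: kinj.
  - by rewrite filter_uniq// iota_uniq.
  move=> k; rewrite mem_filter mem_index_iota andb_idr// => /mapP[i].
  rewrite mem_enum => iC ->; rewrite kpos//= ltnS.
  exact: (leq_bigmax_cond (F := kappa)).
by rewrite big_mkcond ler_sum// => k _; case: ifP => // _; rewrite exprn_ge0; case/andP: x01.
Qed.

(** * Polylogarithms of nonpositive order and powers of [(1 + x) / (1 - x)] *)

Section NegativePolylog.
Local Open Scope classical_set_scope.
Variables (R : realType) (x : R).
Hypothesis x01 : 0 <= x < 1.

(* Partial sums of Li_(-m)(x). *)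
Definition polylog_sum (m : nat) : R ^nat :=
  fun N => \sum_(0 <= k < N) k.+1%:R ^+ m * x ^+ k.+1.

Lemma polylog_sumS m N : polylog_sum m N.+1 = polylog_sum m N + N.+1%:R ^+ m * x ^+ N.+1.
Proof. by rewrite /polylog_sum big_nat_recr. Qed.

Lemma polylog_sum_nondecreasing m : nondecreasing_seq (polylog_sum m).
Proof.
apply/nondecreasing_seqP => N; by rewrite polylog_sumS lerDl mulr_ge0// exprn_ge0//; case/andP: x01.
Qed.

(** The difference of powers factors into [m.+1] products of degree [m] in [k.+1] and [k], each at
    most [k.+1 ^ m]. *)
Lemma exprB_le (m k : nat) : (k.+1%:R ^+ m.+1 - k%:R ^+ m.+1 : R) <= m.+1%:R * k.+1%:R ^+ m.
Proof.
rewrite subrXX -natrB// subSn// subnn mul1r -[m.+1 in leRHS]card_ord mulr_natl -sumr_const.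
apply: ler_sum => i _; rewrite -[in leRHS](subnK (leq_ord i)) exprD.
by rewrite /= ler_wpM2l// lerXn2r ?nnegrE// ler_nat.
Qed.

(* Abel summation: multiplying by 1 - x lowers the power m by one. *)
Lemma polylog_sum_bounded m : exists M, forall N, polylog_sum m N <= M.
Proof.
have /andP[x0 x1] := x01; have x1' : 0 < 1 - x by rewrite subr_gt0.
elim: m => [|m [M IH]].
  exists (x / (1 - x)) => N; apply: le_trans (sum_geometric_le _ _ N.+1 x01).
  by rewrite big_add1 /= le_eqVlt; apply/orP; left; apply/eqP; apply: eq_bigr => k _; rewrite expr0 mul1r.
exists (m.+1%:R * M / (1 - x)) => N; rewrite ler_pdivlMr// mulrC.
apply: le_trans (ler_wpM2l _ (IH N)) => //.
(* The extra summand is the boundary term of the Abel summation; with it, both sides grow termwise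
   and induction on [N] goes through. *)
suff : (1 - x) * polylog_sum m.+1 N + N%:R ^+ m.+1 * x ^+ N.+1 <= m.+1%:R * polylog_sum m N.
  by apply: le_trans; rewrite lerDl mulr_ge0 ?exprn_ge0.
elim: N => [|N IHN]; first by rewrite /polylog_sum !big_geq// !mulr0 expr0n mul0r addr0.
rewrite !polylog_sumS !mulrDr.
have := exprB_le m N; move/(ler_wpM2r (exprn_ge0 N.+1 x0)).
move: IHN; rewrite [x ^+ N.+2]exprS; lra.
Qed.

Lemma polylog_sum_cvg m : cvgn (polylog_sum m).
Proof.
apply: nondecreasing_is_cvgn; first exact: polylog_sum_nondecreasing.
by have [M hM] := polylog_sum_bounded m; exists M => _ [N _ <-].
Qed.

(** In the factorization of the difference of powers, keep only the two extreme products, [k.+1 ^ m]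
    and [k ^ m]. For [m = 0] they are one and the same product, so that case is computed
    directly. *)
Lemma expr_trapezoid_le (m k : nat) : (0 < k)%N -> (m.+1%:R * (k.+1%:R ^+ m + k%:R ^+ m) : R) <=
  m.+2%:R * (k.+1%:R ^+ m.+1 - k%:R ^+ m.+1).
Proof.
move=> k0; rewrite subrXX -natrB// subSn// subnn mul1r.
case: m => [|m]; first by rewrite big_ord_recl big_ord0 !expr0; lra.
rewrite big_ord_recl big_ord_recr /= expr0 mulr1 /bump /= add1n subnn expr0 mul1r subn0.
apply: ler_pM; rewrite ?ler0n ?ler_nat ?addr_ge0 ?exprn_ge0//.
rewrite lerD2l lerDr; apply: sumr_ge0 => i _; by rewrite mulr_ge0// exprn_ge0.
Qed.

(** Truncated form of [2x + 2(m+1)(1+x) Li_(-m)(x) <= 2(m+2)(1-x) Li_(-m-1)(x)]. Truncating at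
    [N.+1] and, after the factor [x], at [N] gives both sides the same top power of [x], so each
    induction step compares one coefficient. The term [2x] makes the coefficients of [x] equal. *)
Lemma polylog_sum_recurrence_partial (m N : nat) :
  2 * x + 2 * m.+1%:R * (polylog_sum m N.+1 + x * polylog_sum m N) <=
  2 * m.+2%:R * (polylog_sum m.+1 N.+1 - x * polylog_sum m.+1 N).
Proof.
have /andP[x0 x1] := x01.
elim: N => [|N IH].
  rewrite /polylog_sum !big_nat1 !big_geq// !expr1n !mul1r; lra.
rewrite (polylog_sumS m N.+1) (polylog_sumS m.+1 N.+1) {2}(polylog_sumS m N) {2}(polylog_sumS m.+1 N).
have := expr_trapezoid_le m N.+1 isT; move/(ler_wpM2r (exprn_ge0 N.+2 x0)).
move: IH; rewrite ![x ^+ N.+2]exprS; lra.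
Qed.

Lemma ratio_exp_le_polylog (m : nat) :
  ((1 + x) / (1 - x)) ^+ m.+1 <= 1 + 2 * m.+1%:R * limn (polylog_sum m).
Proof.
have /andP[x0 x1] := x01; have x1' : 0 < 1 - x by rewrite subr_gt0.
have cS q : (fun N => polylog_sum q N.+1) @ \oo --> limn (polylog_sum q).
  by rewrite (cvg_shiftS (polylog_sum q)); exact: polylog_sum_cvg.
have cstc (a : R) : (fun=> a) @ \oo --> a by exact: cvg_cst.
have cX q : (fun N => x * polylog_sum q N) @ \oo --> x * limn (polylog_sum q).
  by apply: cvgM; [exact: cvg_cst|exact: polylog_sum_cvg].
have rec p : 2 * x + 2 * p.+1%:R * (limn (polylog_sum p) + x * limn (polylog_sum p)) <=
    2 * p.+2%:R * (limn (polylog_sum p.+1) - x * limn (polylog_sum p.+1)).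
  have cl := cvgD (cstc (2 * x)) (cvgM (cstc (2 * p.+1%:R)) (cvgD (cS p) (cX p))).
  have cr := cvgM (cstc (2 * p.+2%:R)) (cvgB (cS p.+1) (cX p.+1)).
  by refine (ler_cvg_to (cl _ _ _) (cr _ _) _); apply: nearW => N; exact: polylog_sum_recurrence_partial.
elim: m => [|m IH].
  rewrite expr1 ler_pdivrMr//.
  (* For exponent 1, the claim multiplied by [1 - x] is [x <= (1 - x) Li_0(x)], which telescopes on
     partial sums. *)
  suff : x <= limn (polylog_sum 0) - x * limn (polylog_sum 0) by lra.
  have key N : x <= polylog_sum 0 N.+1 - x * polylog_sum 0 N.
    elim: N => [|N IH]; first by rewrite polylog_sumS /polylog_sum big_geq// expr0; lra.
    rewrite (polylog_sumS 0 N.+1) {2}(polylog_sumS 0 N) ![x ^+ N.+2]exprS !expr0.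
    lra.
  by apply: cvgr_to_ge (cvgB (cS 0) (cX 0)) _; apply: nearW => N; exact: key.
(* Multiply the induction hypothesis by [1 + x = (1 - x) + 2 * x]; the [2 * x] is the one that [rec]
   absorbs. *)
rewrite exprSr mulrA ler_pdivrMr//.
have := rec m; have : 0 <= 1 + x by lra.
move=> /ler_wpM2r /(_ _ _ IH); lra.
Qed.
End NegativePolylog.

(** * Sums over one residue class, on a line and on a lattice *)

(** For [j] congruent to [i], the exponent is the distance between the quotients by [m]. On each
    side of [i] these distances are distinct and positive, so each side contributes at most one
    geometric series. *)
Lemma sum_congruent_exp_le (R : realFieldType) (n m i : nat) (x : R) :
  0 <= x < 1 -> (0 < m)%N ->
  \sum_(j < n | (j != i :> nat) && (j == i %[mod m])) x ^+ (`|i - j| %/ m)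
    <= 2 * (x / (1 - x)).
Proof.
move=> x01 m0; rewrite (bigID (fun j : 'I_n => (i < j)%N)) /= mulr_natl mulr2n.
have divm (j : nat) : j == i %[mod m] -> (`|i - j| %/ m = `|i %/ m - j %/ m|)%N.
  move=> /eqP ji; rewrite {1}(divn_eq i m) {1}(divn_eq j m) ji distnDr.
  by rewrite -[X in (X %/ m)%N]/(absz _) PoszM PoszM -mulrBl abszM mulnK.
have eqdiv (j k : nat) : j == i %[mod m] -> k == i %[mod m] -> (j %/ m = k %/ m)%N -> j = k.
  by move=> /eqP ji /eqP ki e; rewrite (divn_eq j m) (divn_eq k m) e ji ki.
have pos (j : nat) : j != i -> j == i %[mod m] -> (0 < `|i - j| %/ m)%N.
  move=> ji jm; rewrite divm// lt0n distn_eq0; apply: contra ji => /eqP/esym e.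
  by apply/eqP/eqdiv.
apply: lerD; apply: sum_distinct_exp_le => // [j k|j]; rewrite !unfold_in.
- move=> /andP[/andP[_ jm] ij] /andP[/andP[_ km] ik]; rewrite !divm// => e.
  apply/val_inj/eqdiv => //.
  by have := leq_div2r m (ltnW ij); have := leq_div2r m (ltnW ik); lia.
- by case/andP=> /andP[? ?] _; apply: pos.
- move=> /andP[/andP[_ jm] ij] /andP[/andP[_ km] ik]; rewrite !divm// => e.
  apply/val_inj/eqdiv => //; rewrite -!leqNgt in ij ik.
  by have := leq_div2r m ij; have := leq_div2r m ik; lia.
- by case/andP=> /andP[? ?] _; apply: pos.
Qed.

Definition lattice_congr {D : nat} {L : 'I_D -> nat} (m : nat) : rel (lattice L) :=
  fun u w => [forall k, w k == u k %[mod m]].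

(** For nodes congruent coordinatewise modulo [m], this is their l1 distance divided by [m]. *)
Definition cell_dist {D : nat} {L : 'I_D -> nat} (m : nat) (u w : lattice L) : nat :=
  (\sum_k `|u k - w k| %/ m)%N.

(** The summand is a product over coordinates, so the sum is at most a product of one-coordinate
    sums, each bounded by [1 + 2 * (x / (1 - x))]. *)
Lemma sum_lattice_class_le (R : realFieldType) (D : nat) (L : 'I_D -> nat)
    (m : nat) (u : lattice L) (x : R) : 0 <= x < 1 -> (0 < m)%N ->
  \sum_(w : lattice L | lattice_congr m u w)
    x ^+ cell_dist m u w <= ((1 + x) / (1 - x)) ^+ D.
Proof.
move=> x01 m0; have [x0 x1] := andP x01.
(* The coordinate types ['I_(L k)] vary with [k]. Embedding them all in ['I_M.+1] allows the
   exchange of product and sum, and only adds nonnegative terms. *)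
pose M := (\max_k L k)%N.
have ltM k (a : 'I_(L k)) : (a < M.+1)%N.
  by rewrite ltnS; apply: leq_trans (ltnW (ltn_ord a)) (leq_bigmax k).
pose h (w : lattice L) : {ffun 'I_D -> 'I_M.+1} := [ffun k => Ordinal (ltM k (w k))].
have h_inj : injective h.
  move=> w w' /ffunP e; apply/ffunP => k; apply: val_inj.
  by have := congr1 val (e k); rewrite !ffunE.
pose Q k (a : 'I_M.+1) := (a == u k %[mod m]).
pose F k (a : 'I_M.+1) := x ^+ (`|u k - a| %/ m).
have F0 k a : 0 <= F k a by rewrite exprn_ge0.
apply: (@le_trans _ _ (\sum_(g in family Q) \prod_k F k (g k))).
  rewrite [leLHS](_ : _ = \sum_(g in h @: [set w | lattice_congr m u w])
     \prod_k F k (g k)).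
    rewrite [leRHS]big_mkcond [leLHS]big_mkcond; apply: ler_sum => g _.
    case: ifP => [/imsetP[w]|_]; last by case: ifP => // _; apply: prodr_ge0.
    rewrite inE => /forallP wu ->; case: ifP => [//|/familyP[]] k.
    by rewrite ffunE; apply: wu.
  rewrite big_imset /=; last by move=> ? ? _ _; apply: h_inj.
  apply: eq_big => [w|w _]; first by rewrite inE.
  rewrite -expr_sum; congr (_ ^+ _); by apply: eq_bigr => k _; rewrite ffunE.
apply: (@le_trans _ _ (\prod_k \sum_(a in Q k) F k a)).
  by rewrite bigA_distr_big_dep.
rewrite -[in leRHS](card_ord D) -prodr_const.
apply: ler_prod => k _; apply/andP; split; first by apply: sumr_ge0 => a _; apply: F0.
rewrite (bigD1 (Ordinal (ltM k (u k)))) /=; last exact: eqxx.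
rewrite {1}/F /= distnn div0n expr0.
have -> : (1 + x) / (1 - x) = 1 + 2 * (x / (1 - x)).
  by field; rewrite subr_eq0 gt_eqF.
rewrite lerD2l; apply: le_trans (sum_congruent_exp_le _ M.+1 m (u k) x x01 m0).
by rewrite le_eqVlt; apply/orP; left; apply/eqP; apply: eq_bigl => a; rewrite andbC.
Qed.

(** Uniqueness of base-[b] digits: reduction modulo [b] isolates the lowest one, and the rest is [b]
    times a shorter expansion. *)
Lemma digits_inj (b D : nat) (a c : 'I_D -> nat) :
  (forall k, (a k < b)%N) -> (forall k, (c k < b)%N) ->
  (\sum_k a k * b ^ k = \sum_k c k * b ^ k)%N -> a =1 c.
Proof.
elim: D a c => [|D IH] a c ab cb; first by move=> _ [].
rewrite !big_ord_recl /= !expn0 !muln1.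
have step (e : 'I_D.+1 -> nat) : (\sum_(i < D) e (lift ord0 i) * b ^ bump 0 i =
    (\sum_(i < D) e (lift ord0 i) * b ^ i) * b)%N.
  by rewrite big_distrl; apply: eq_bigr => i _; rewrite /bump leq0n add1n expnSr mulnA.
rewrite !step => e.
have e0 : a ord0 = c ord0.
  by have := congr1 (modn^~ b) e; rewrite /= ![(_ + _ * b)%N]addnC !modnMDl !modn_small.
have b0 : (0 < b)%N := leq_ltn_trans (leq0n _) (ab ord0).
move: e; rewrite e0 => /addnI/eqP; rewrite eqn_pmul2r// => /eqP e k.
have [j ->|-> //] := unliftP ord0 k.
by rewrite (IH (fun i => a (lift ord0 i)) (fun i => c (lift ord0 i))).
Qed.

(** * Lower bounds on the geodesic distance, and what equal colors imply *)

Section Walks.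
Variables (T : finType) (e : rel T).

(** Triangle inequality along the walk. It serves for [|i - j|] with edges of length at most the
    bandwidth, and for the l1 distance on the lattice with edges of length 1. *)
Lemma has_walk_le (dist : T -> T -> nat) (b : nat) :
  (forall i, dist i i = 0%N) ->
  (forall i j k, dist i k <= dist i j + dist j k)%N ->
  (forall i j, e i j -> dist i j <= b)%N ->
  forall i j k, has_walk e i j k -> (dist i j <= k * b)%N.
Proof.
move=> dii dtri dedge i j k /existsP[p /andP[ep /eqP <-]].
rewrite -[k in leqRHS](size_tuple p).
elim: {p k}(tval p) i ep => [i _|y s IH i /= /andP[eiy es]]; first by rewrite dii.
apply: leq_trans (dtri _ y _) _; rewrite mulSn.
by apply: leq_add; [apply: dedge|apply: IH].
Qed.

Lemma geodist_walk i j k : geodist e i j = Some k -> has_walk e i j k.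
Proof. by rewrite /geodist; case: pselect => // ex [<-]; case: ex_minnP. Qed.

End Walks.

Lemma banded_geodist (R : realType) (n b : nat) (A : 'M[R]_n) i j k :
  banded b A -> geodist (mxgraph A) i j = Some k -> (`|i - j| <= k * b)%N.
Proof.
move=> Ab /geodist_walk; apply: (has_walk_le _ _ (fun i j : 'I_n => `|i - j|%N)) => [?|? ? ?|u v].
- by rewrite distnn.
- by lia.
- by case/andP=> _; apply: contraR; rewrite -ltnNge => /Ab ->.
Qed.

Lemma lattice_geodist (D : nat) (L : 'I_D -> nat) (T : finType) (e : rel T)
    (v : T -> lattice L) i j k :
  (forall i j, e i j = lattice_adj (v i) (v j)) ->
  geodist e i j = Some k -> (\sum_h `|v i h - v j h| <= k)%N.
Proof.
move=> ev /geodist_walk; rewrite -[k in leqRHS]muln1.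
apply: (has_walk_le _ _ (fun i j => \sum_h `|v i h - v j h|)%N) => [a|a b c|a b].
- by rewrite big1// => h _; rewrite distnn.
- by rewrite -big_split; apply: leq_sum => h _ /=; lia.
- rewrite ev => /existsP[h /andP[/eqP vh /forallP vne]].
  rewrite (bigD1 h) //= vh big1// => g gh.
  by have := vne g; rewrite gh => /eqP ->; rewrite distnn.
Qed.

Lemma lattice_col_congr (d D : nat) (L : 'I_D -> nat) (u w : lattice L) :
  lattice_col d u = lattice_col d w -> forall k, w k = u k %[mod d + 1].
Proof.
rewrite /lattice_col => /addIn e k.
have lt (x : nat) : (x %% (d + 1) < d + 1)%N by rewrite ltn_mod addn1.
by rewrite (digits_inj (d + 1) D (fun k => u k %% (d + 1))%N (fun k => w k %% (d + 1))%N).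
Qed.

Lemma trmx_matfun (R : realType) (n : nat) (f : R -> R) (A : 'M[R]_n) :
  (matfun f A)^T = matfun f A.
Proof. by rewrite /matfun !trmx_mul trmxK tr_diag_mx mulmxA. Qed.

(** Dividing by a power of exponent [-m] multiplies by the power of exponent [m]. The shift by one
    arises because [polylog] sums over [1 <= k < N], which is [N - 1] terms. *)
Lemma polylog_lim (R : realType) (m : nat) (x : R) : 0 <= x < 1 ->
  polylog (1 - m.+1%:Z) x = limn (polylog_sum R x m).
Proof.
move=> x01; rewrite /polylog.
have -> : 1 - m.+1%:Z = - m%:Z by lia.
set u := (X in limn X).
apply/cvg_lim => //; rewrite -(cvg_shiftS u).
rewrite (_ : (fun N => u N.+1) = polylog_sum R x m); first exact: polylog_sum_cvg.
apply/funext => N; rewrite /u /polylog_sum big_add1 /=; apply: eq_bigr => k _.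
by rewrite -exprnN invrK mulrC.
Qed.

(** * Averages over sign patterns *)

Section Signs.
Variables (R : realType) (n : nat) (C : {set 'I_n}).
Implicit Types (S : {set 'I_n}) (i j : 'I_n).

(** A sign pattern is encoded by the set [S] of its positive indices; when [S] lies in [C], indices
    outside [C] get the default -1. *)
Definition sign S i : R := if i \in S then 1 else -1.

(** The expectation of [g] under independent uniform signs on [C]. *)
Definition sign_mean (g : {set 'I_n} -> R) : R :=
  2^-1 ^+ #|C| * \sum_(S in powerset C) g S.

Lemma sign_mean_sum (I : Type) (r : seq I) (P : pred I) (F : I -> {set 'I_n} -> R) :
  sign_mean (fun S => \sum_(i <- r | P i) F i S) = \sum_(i <- r | P i) sign_mean (F i).
Proof. by rewrite /sign_mean exchange_big /= mulr_sumr. Qed.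

Lemma sign_meanZ (a : R) g : sign_mean (fun S => a * g S) = a * sign_mean g.
Proof. by rewrite /sign_mean -mulr_sumr mulrCA. Qed.

Lemma sign_mean_cst (a : R) : sign_mean (fun=> a) = a.
Proof.
rewrite /sign_mean sumr_const card_powerset -[a *+ _]mulr_natl natrX mulrA -exprMn.
by rewrite mulVf ?expr1n ?mul1r// pnatr_eq0.
Qed.

Definition flip i S := [set j | (j \in S) (+) (j == i)].

Lemma flipK i : involutive (flip i).
Proof. by move=> S; apply/setP => j; rewrite !inE -addbA addbb addbF. Qed.

Lemma sign_flip i S j : sign (flip i S) j = if j == i then - sign S j else sign S j.
Proof. by rewrite /sign !inE; case: (j \in S); case: (j == i) => //=; rewrite opprK. Qed.

(** Flipping the sign at [i] permutes the subsets of [C], so the sum equals its own opposite. *)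
Lemma sign_mean_flip i g : i \in C -> (forall S, g (flip i S) = - g S) ->
  sign_mean g = 0.
Proof.
move=> iC gN; rewrite /sign_mean.
suff : \sum_(S in powerset C) g S = - \sum_(S in powerset C) g S.
  by move=> e; rewrite (_ : \sum_(S in _) _ = 0) ?mulr0//; lra.
rewrite [LHS](reindex_inj (inv_inj (flipK i))) -sumrN; apply: eq_big => [S|S _]; last exact: gN.
rewrite !powersetE; apply/fintype.subsetP/fintype.subsetP => h j.
  by have := h j; rewrite inE; case: (eqVneq j i) => [->|] //; rewrite addbF.
by have := h j; rewrite inE; case: (eqVneq j i) => [->|] //; rewrite addbF.
Qed.

Lemma sign_sqr S i : sign S i * sign S i = 1.
Proof. by rewrite /sign; case: ifP; rewrite ?mulr1 ?mulrNN ?mulr1. Qed.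

Lemma sign_mean2 i j : i \in C -> i != j -> sign_mean (fun S => sign S i * sign S j) = 0.
Proof.
move=> iC ij; apply: (sign_mean_flip i) => // S.
by rewrite !sign_flip eqxx eq_sym (negbTE ij) mulNr.
Qed.

(** If [i] or [j] is missing from [{k, l}], flipping it negates the product and the mean is 0.
    Otherwise [{k, l} = {i, j}] and the product is constantly 1. *)
Lemma sign_mean4 i j k l : i \in C -> j \in C -> i != j -> k != l ->
  sign_mean (fun S => (sign S i * sign S j) * (sign S k * sign S l)) =
  ((k == i) && (l == j))%:R + ((k == j) && (l == i))%:R.
Proof.
move=> iC jC ij kl.
have [/norP[/negbTE ki /negbTE li]|iin] := boolP (~~ ((k == i) || (l == i))).
  rewrite ki li andbF addr0; apply: (sign_mean_flip i) => // S.
  by rewrite !sign_flip eqxx ki li eq_sym (negbTE ij) !mulNr.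
have [/norP[/negbTE kj /negbTE lj]|jin] := boolP (~~ ((k == j) || (l == j))).
  rewrite kj lj andbF addr0; apply: (sign_mean_flip j) => // S.
  by rewrite !sign_flip eqxx kj lj (negbTE ij) mulrN !mulNr.
have sgn1 a b : sign_mean (fun S => sign S a * sign S b * (sign S a * sign S b)) = 1.
  rewrite -[RHS]sign_mean_cst; congr sign_mean; apply/funext => S.
  by rewrite mulrACA !sign_sqr mulr1.
move: iin jin; rewrite !negbK => /orP[/eqP ki|/eqP li] /orP[/eqP kj|/eqP lj].
- by rewrite -ki kj eqxx in ij.
- by rewrite ki lj sgn1 !eqxx (negbTE ij) addr0.
- rewrite kj li !eqxx [j == i]eq_sym (negbTE ij) add0r -[RHS](sgn1 i j).
  by congr sign_mean; apply/funext => S; rewrite [sign S j * _]mulrC.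
- by rewrite -li lj eqxx in ij.
Qed.
End Signs.

(** * Mean and variance of a quadratic form in signs *)

Section QuadraticForm.
Variables (R : realType) (n : nat) (C : {set 'I_n}) (B : 'M[R]_n).

Definition sign_form (S : {set 'I_n}) : R :=
  \sum_(i in C) \sum_(j in C) B i j * (sign R n S i * sign R n S j).

Lemma sign_form_split S : sign_form S = \sum_(i in C) B i i +
  \sum_(i in C) \sum_(j in C | j != i) B i j * (sign R n S i * sign R n S j).
Proof.
rewrite -big_split; apply: eq_bigr => i iC.
by rewrite (bigD1 i)//= sign_sqr mulr1.
Qed.

Lemma sign_mean_form : sign_mean R n C sign_form = \sum_(i in C) B i i.
Proof.
rewrite sign_mean_sum; apply: eq_bigr => i iC.
rewrite sign_mean_sum (bigD1 i)//= sign_meanZ.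
under [X in sign_mean _ _ _ X]funext do rewrite sign_sqr.
rewrite sign_mean_cst mulr1 big1 ?addr0// => j /andP[jC ji].
by rewrite sign_meanZ sign_mean2 ?mulr0// eq_sym.
Qed.

(** Expand the square into a fourfold sum. Only [(k, l) = (i, j)] and [(k, l) = (j, i)] survive
    averaging, and by symmetry of [B] each gives [B i j ^+ 2], whence the factor 2. *)
Lemma sign_mean_form_var : B^T = B ->
  sign_mean R n C (fun S => (sign_form S - \sum_(i in C) B i i) ^+ 2) =
  2 * \sum_(i in C) \sum_(j in C | j != i) B i j ^+ 2.
Proof.
move=> Bs; have BC i j : B j i = B i j by rewrite -{1}Bs mxE.
pose o S i j := sign R n S i * sign R n S j.
transitivity (sign_mean R n C (fun S =>
    \sum_(i in C) \sum_(j in C | j != i) \sum_(k in C) \sum_(l in C | l != k)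
      B i j * B k l * (o S i j * o S k l))).
  congr sign_mean; apply/funext => S; rewrite sign_form_split addrAC subrr add0r expr2 mulr_suml.
  apply: eq_bigr => i _; rewrite mulr_suml; apply: eq_bigr => j _; rewrite mulr_sumr.
  apply: eq_bigr => k _; rewrite mulr_sumr; apply: eq_bigr => l _.
  by rewrite mulrACA.
rewrite sign_mean_sum mulr_sumr; apply: eq_bigr => i iC.
rewrite sign_mean_sum mulr_sumr; apply: eq_bigr => j /andP[jC ji].
rewrite sign_mean_sum.
under eq_bigr do rewrite sign_mean_sum.
have ij : i != j by rewrite eq_sym.
transitivity (\sum_(k in C) \sum_(l in C | l != k) (B i j * B k l *
     (((k == i) && (l == j))%:R + ((k == j) && (l == i))%:R))).
  apply: eq_bigr => k kC; apply: eq_bigr => l /andP[lC lk].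
  by rewrite sign_meanZ sign_mean4// eq_sym.
have pick a b : a \in C -> b \in C -> b != a ->
    \sum_(k in C) \sum_(l in C | l != k) B i j * B k l * ((k == a) && (l == b))%:R =
    B i j * B a b.
  move=> aC bC ba; rewrite (bigD1 a)//= (bigD1 b) ?bC//= !eqxx mulr1.
  rewrite big1 => [|l /andP[_ /negbTE ->]]; last by rewrite andbF mulr0.
  rewrite big1 ?addr0// => k /andP[_ /negbTE ->].
  by rewrite big1// => l _; rewrite mulr0.
under eq_bigr do (under eq_bigr do rewrite mulrDr); under eq_bigr do rewrite big_split.
by rewrite big_split /= !pick// BC expr2 mulr_natl mulr2n.
Qed.

End QuadraticForm.

(** * From random signs to finite averages *)

Section Probing.
Context {R : realType} {disp : measure_display} {T : measurableType disp}.
Variables (P : probability T R) (n : nat) (C : {set 'I_n}) (X : 'I_n -> {RV P >-> R}).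
Hypothesis iidX : iid_rademacher C X.
Local Open Scope classical_set_scope.

Definition sign_event (S : {set 'I_n}) : set T :=
  [set t | forall i, i \in C -> X i t = sign R n S i].

Lemma measurable_sign_event S : measurable (sign_event S).
Proof.
rewrite (_ : sign_event S = \bigcap_(i in [set` C]) (X i @^-1` [set sign R n S i])).
  exact: fin_bigcap_measurable.
by apply/seteqP; split => t h i /h.
Qed.

(* There are 2^#|C| of these disjoint events, so together they have probability 1
   and every expectation reduces to the finite average [sign_mean]. *)
Lemma probability_sign_event S : P (sign_event S) = (2^-1 ^+ #|C|)%:E.
Proof.
have [ind rad] := iidX.
have := ind C (fun i => [set sign R n S i]) (subxx C) (fun i _ => measurable_set1 _).
rewrite /sign_event => ->.
rewrite -prodr_const -prodEFin; apply: eq_bigr => i iC.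
by have [p1 pN1] := rad i iC; rewrite /sign; case: ifP.
Qed.

(** At a common point the patterns agree on [C], since 1 and -1 differ; off [C] both sets are empty,
    as only subsets of [C] are used. *)
Lemma trivIset_sign_event : trivIset [set` powerset C] sign_event.
Proof.
move=> S S' /=; rewrite !powersetE => /fintype.subsetP SC /fintype.subsetP SC' [t [tS tS']].
have sgn_inj i : i \in C -> (i \in S) = (i \in S').
  move=> iC; have := tS i iC; rewrite (tS' i iC) /sign.
  by case: ifP; case: ifP => // _ _; lra.
apply/setP => i; have [/sgn_inj //|iC] := boolP (i \in C).
by rewrite (contraNF (SC i) iC) (contraNF (SC' i) iC).
Qed.

(** On each sign event [h] is constant. The variables are only almost surely 1 or -1, so the
    complement of all these events has to be shown null. *)
Lemma expectation_sign (h : T -> R) (g : {set 'I_n} -> R) :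
  measurable_fun setT h -> (forall S t, sign_event S t -> h t = g S) ->
  'E_P[h]%E = (sign_mean R n C g)%:E.
Proof.
move=> mh hg.
(* Stated for a general [f]: the constant 1 gives the probability of the union, and [h] then gives
   the expectation. *)
have integral_D (f : T -> R) (f' : {set 'I_n} -> R) : measurable_fun setT f ->
    (forall S t, sign_event S t -> f t = f' S) ->
    (\int[P]_(t in \big[setU/set0]_(S <- enum (powerset C)) sign_event S) (f t)%:E)%E =
    (sign_mean R n C f')%:E.
  move=> mf ff'; rewrite integral_bigsetU_EFin//.
  - rewrite big_enum /= /sign_mean mulr_sumr -sumEFin; apply: eq_bigr => S _.
    under eq_integral => t /set_mem/ff' -> do [].
    rewrite integral_cst; last exact: measurable_sign_event.
    by rewrite mulrC EFinM; congr (_ * _)%E; exact: probability_sign_event.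
  - by move=> S; apply: measurable_sign_event.
  - exact: enum_uniq.
  - by apply: sub_trivIset trivIset_sign_event => S /=; rewrite mem_enum.
  - by apply/measurable_EFinP; apply: measurable_funS mf.
set D := (X in integral _ X) in integral_D.
have mD : measurable D by apply: bigsetU_measurable => S _; apply: measurable_sign_event.
have PD : P (~` D) = 0%E.
  have PD1 : P D = 1%E.
    rewrite -[P D]mul1e -integral_cst//.
    have := integral_D (cst 1) (fun=> 1) (measurable_cst _) (fun _ _ _ => erefl).
    by rewrite sign_mean_cst.
  by rewrite probability_setC// PD1 -EFinB subrr.
rewrite unlock -(setUv D) integral_setU_EFin//; last 3 first.
- exact: measurableC.
- by rewrite setUv.
- by rewrite /disj_set setICr eqxx.
rewrite (integral_D h g)// null_set_integral ?adde0//; first exact: measurableC.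
by apply/measurable_EFinP; apply: measurable_funS mh.
Qed.

Lemma probing_formE (B : 'M[R]_n) t :
  probing_form B C X t = \sum_(i in C) \sum_(j in C) B i j * (X i t * X j t).
Proof.
have wE i : probing_vector C X t i 0 = if i \in C then X i t else 0.
  rewrite /probing_vector summxE; case: ifP => iC.
    rewrite (bigD1 i)//= !mxE !eqxx mulr1 big1 ?addr0// => j /andP[_ ji].
    by rewrite !mxE eq_sym (negbTE ji) mulr0.
  by rewrite big1// => j jC; rewrite !mxE; case: eqP => [e|_]; [rewrite e jC in iC|rewrite mulr0].
rewrite /probing_form mxE [RHS]exchange_big [RHS]big_mkcond /=; apply: eq_bigr => j _.
rewrite wE; case: ifP => jC; last by rewrite mulr0.
rewrite mxE mulr_suml [RHS]big_mkcond; apply: eq_bigr => i _.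
by rewrite mxE wE; case: ifP => _; [ring|rewrite !mul0r].
Qed.

Lemma probing_varianceE (B : 'M[R]_n) : B^T = B ->
  probing_variance B C X =
    (2 * \sum_(i in C) \sum_(j in C | j != i) B i j ^+ 2)%:E.
Proof.
move=> Bs.
have mform : measurable_fun setT (probing_form B C X).
  rewrite (_ : probing_form B C X = fun t => \sum_(i in C) \sum_(j in C) B i j * (X i t * X j t));
    last by apply/funext => t; rewrite probing_formE.
  have msum (F : 'I_n -> T -> R) : (forall i, measurable_fun setT (F i)) ->
      measurable_fun setT (fun t => \sum_(i in C) F i t).
    by move=> mF; under eq_fun do rewrite -big_enum; exact: measurable_sum.
  apply: (msum (fun i t => \sum_(j in C) B i j * (X i t * X j t))) => i.
  refine (msum (fun j t => B i j * (X i t * X j t)) _) => j.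
  by apply: measurable_funM => //; apply: measurable_funM.
have formE S t : sign_event S t -> probing_form B C X t = sign_form R n C B S.
  move=> tS; rewrite probing_formE; apply: eq_bigr => i iC; apply: eq_bigr => j jC.
  by rewrite !tS.
rewrite /probing_variance /variance unlock (expectation_sign _ _ mform formE) sign_mean_form /=.
rewrite (expectation_sign _ (fun S => (sign_form R n C B S - \sum_(i in C) B i i) ^+ 2)).
- by rewrite sign_mean_form_var.
- by apply: measurable_funM; apply: measurable_funB.
- by move=> S t /formE e; rewrite expr2 /= -e.
Qed.

End Probing.

(** * Variance bounds for the two colorings *)

(** Common reduction of both cases: [s] counts the periods between two nodes of one color, and
    [2 * K] bounds each row sum. The exact variance contributes another factor 2, giving the
    constant 4. *)
Lemma probing_variance_le (R : realType) (n : nat) (A : 'M[R]_n) (f : R -> R)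
    (d : nat) (c q K : R) (C : {set 'I_n}) (s : 'I_n -> 'I_n -> nat) :
  0 < c -> 0 < q < 1 ->
  (forall i j : 'I_n,
      `|matfun f A i j| <= c * qpow q (geodist (mxgraph A) i j)) ->
  (forall i j m, i \in C -> j \in C -> geodist (mxgraph A) i j = Some m -> (d * s i j <= m)%N) ->
  (forall i, i \in C -> \sum_(j in C | j != i) (q ^+ (2 * d)) ^+ s i j <= 2 * K) ->
  forall (disp : measure_display) (T : measurableType disp)
      (P : probability T R) (X : 'I_n -> {RV P >-> R}),
      iid_rademacher C X ->
      (probing_variance (matfun f A) C X <= (#|C|%:R * (4 * c ^+ 2 * K))%:E)%E.
Proof.
move=> c0 /andP[q0 q1] decay dist_ge sumK disp T P X iidX.
rewrite (probing_varianceE P n C X iidX _ (trmx_matfun _ _ _ _)) lee_fin.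
have ent i j : i \in C -> j \in C ->
    matfun f A i j ^+ 2 <= c ^+ 2 * (q ^+ (2 * d)) ^+ s i j.
  move=> iC jC; have := decay i j; have := dist_ge i j.
  (* At infinite distance [qpow] is 0, so the decay bound forces the entry to vanish. *)
  case: geodist => [m|] /=; last first.
    move=> _; rewrite mulr0 normr_le0 => /eqP ->; rewrite expr0n.
    by rewrite mulr_ge0// exprn_ge0// ?exprn_ge0// ltW.
  move=> /(_ m iC jC erefl) sm fij.
  rewrite -[matfun f A i j ^+ 2]real_normK ?num_real//.
  apply: (@le_trans _ _ ((c * q ^+ (d * s i j)) ^+ 2)).
    apply: lerXn2r; rewrite ?nnegrE// ?mulr_ge0// ?exprn_ge0// ?(ltW c0) ?(ltW q0)//.
    apply: le_trans fij _; rewrite ler_pM2l//.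
    by rewrite ler_wiXn2l// ltW.
  by rewrite exprMn -!exprM [(d * _ * 2)%N]mulnC mulnA.
apply: (@le_trans _ _ (2 * \sum_(i in C) c ^+ 2 * (2 * K))).
  rewrite ler_pM2l//; apply: ler_sum => i iC.
  apply: le_trans (ler_wpM2l _ (sumK i iC)); last by rewrite exprn_ge0// ltW.
  by rewrite mulr_sumr; apply: ler_sum => j /andP[jC _]; apply: ent.
by rewrite sumr_const -mulr_natl; lra.
Qed.

Theorem proposition3p9 (R : realType) (n : nat) (A : 'M[R]_n) (f : R -> R)
    (d : nat) (c q : R)
    (A_sym : A^T = A) (d_ge1 : (1 <= d)%N) (c_gt0 : 0 < c)
    (q_gt0 : 0 < q) (q_lt1 : q < 1)
    (decay : forall i j : 'I_n,
      `|matfun f A i j| <= c * qpow q (geodist (mxgraph A) i j)) :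
  (forall (b : nat), (1 <= b)%N -> banded b A ->
    forall l : nat, (1 <= l <= d * b + 1)%N ->
    let C := color_class (@band_col n d b) l in
    forall (disp : measure_display) (T : measurableType disp)
      (P : probability T R) (X : 'I_n -> {RV P >-> R}),
      iid_rademacher C X ->
      (probing_variance (matfun f A) C X <=
        (#|C|%:R * (4 * c ^+ 2 * (q ^+ (2 * d) / (1 - q ^+ (2 * d)))))%:E)%E)
  /\
  (forall (D : nat) (L : 'I_D -> nat) (v : 'I_n -> lattice L), (1 <= D)%N ->
    lattice_labeling (mxgraph A) v ->
    forall l : nat, (1 <= l <= (d + 1) ^ D)%N ->
    let C := color_class (fun i => lattice_col d (v i)) l in
    forall (disp : measure_display) (T : measurableType disp)
      (P : probability T R) (X : 'I_n -> {RV P >-> R}),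
      iid_rademacher C X ->
      (probing_variance (matfun f A) C X <=
        (#|C|%:R * (4 * c ^+ 2 * D%:R *
          polylog (1 - D%:Z) (q ^+ (2 * d))))%:E)%E).
Proof.
have q01 : 0 < q < 1 by rewrite q_gt0.
pose y := q ^+ (2 * d).
have y01 : 0 <= y < 1.
  by rewrite exprn_ge0 ?ltW//= exprn_ilt1 ?ltW// -lt0n muln_gt0 d_ge1.
split=> [b b_ge1 Ab l _ C|D L v + [vbij vadj] l _ C].
  apply: (probing_variance_le _ _ A f d c q _ _
    (fun i j : 'I_n => `|i - j| %/ (d * b + 1))%N) => // [i j m iC jC /banded_geodist|i].
    (* With [s] the quotient, [d * s * b <= (d * b + 1) * s <= |i - j| <= m * b]; then cancel
       [b]. *)
    move=> /(_ _ Ab) ijm; rewrite -(leq_pmul2r b_ge1); apply: leq_trans ijm.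
    apply: leq_trans (leq_trunc_div _ (d * b + 1)).
    by rewrite mulnAC mulnC leq_mul2l leq_addr orbT.
  rewrite inE => /eqP iC.
  apply: le_trans (sum_congruent_exp_le _ n (d * b + 1) i _ y01 _); last by rewrite addn1.
  rewrite le_eqVlt; apply/orP; left; apply/eqP; apply: eq_bigl => j.
  by rewrite inE andbC -iC /band_col eqn_add2r.
(* Replacing [D] by [D.+1] turns the order [1 - D] into minus a natural number, as [polylog_lim]
   expects. *)
case: D L v vbij vadj @C => // D L v vbij vadj C _.
rewrite polylog_lim// -/y -(mulrA (4 * _)).
apply: (probing_variance_le _ _ A f d c q _ _
    (fun i j => cell_dist (d + 1) (v i) (v j))) => // [i j m iC jC|i].
  move=> /(lattice_geodist _ _ _ _ _ _ _ _ vadj); apply: leq_trans.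
  rewrite /cell_dist big_distrr; apply: leq_sum => k _ /=.
  apply: leq_trans (leq_trunc_div _ (d + 1)).
  by rewrite mulnC leq_mul2l leq_addr orbT.
rewrite inE => /eqP iC.
have := ratio_exp_le_polylog R y y01 D.
have d1_gt0 : (0 < d + 1)%N by rewrite addn1.
have := sum_lattice_class_le R D.+1 L (d + 1) (v i) y y01 d1_gt0.
(* The term of [v i] itself is [y ^+ 0 = 1] and cancels the 1 in the polylogarithm bound. *)
rewrite (bigD1 (v i))/=; last by apply/forallP.
have -> : cell_dist (d + 1) (v i) (v i) = 0%N.
  by rewrite /cell_dist big1// => k _; rewrite distnn div0n.
rewrite expr0 => h1 h2.
have {h1 h2} := le_trans h1 h2; rewrite -mulrA lerD2l; apply: le_trans.
(* Carried back to indices by the bijection [v], the congruence class of [v i] contains its color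
   class, and the remaining terms are nonnegative. *)
rewrite (reindex v) /=; last exact: onW_bij.
rewrite big_mkcond [leRHS]big_mkcond; apply: ler_sum => j _ /=.
rewrite inE; case: ifP => [/andP[/eqP jC ji]|_]; last first.
  by case: ifP => // _; rewrite exprn_ge0//; case/andP: y01.
rewrite (inj_eq (bij_inj vbij)) ji andbT ifT//.
apply/forallP => k; apply/eqP; apply: lattice_col_congr.
by rewrite iC jC.
Qed.
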